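(* There exists a robust MDP $(\mathcal{S},\mathcal{A},\boldsymbol{r},\mathcal{U},\boldsymbol{p}_0)$ with an sa-rectangular, compact convex uncertainty set $\mathcal{U}$ and with no Blackwell optimal policy: for all $\pi\in\Pi_{\sf H}$ and all $\gamma\in(0,1)$, there exists $\gamma'\in(\gamma,1)$ such that $$\min_{\boldsymbol{P}\in\mathcal{U}}R_{\gamma'}(\pi,\boldsymbol{P})<\sup_{\pi'\in\Pi_{\sf S}}\ \min_{\boldsymbol{P}\in\mathcal{U}}R_{\gamma'}(\pi',\boldsymbol{P}).$$
   Context: A robust MDP (RMDP) is a tuple $(\mathcal{S},\mathcal{A},\boldsymbol{r},\mathcal{U},\boldsymbol{p}_0)$: $\mathcal{S}$ (states) and $\mathcal{A}$ (actions) are finite nonempty sets, $\boldsymbol{r}\in\mathbb{R}^{\mathcal{S}\times\mathcal{A}\times\mathcal{S}}$ is the reward function, the uncertainty set $\mathcal{U}\subset\Delta(\mathcal{S})^{\mathcal{S}\times\mathcal{A}}$ is a nonempty compact set of transition probabilities $\boldsymbol{P}=(\boldsymbol{p}_{sa})_{s,a}$, and $\boldsymbol{p}_0\in\Delta(\mathcal{S})$ is the initial distribution. The set $\mathcal{U}$ is sa-rectangular if $\mathcal{U}=\prod_{(s,a)}\mathcal{U}_{sa}$ with $\mathcal{U}_{sa}\subseteq\Delta(\mathcal{S})$. $\Pi_{\sf H}$ is the set of history-dependent, possibly randomized policies (the distribution of $a_t$ may depend on $(s_0,a_0,\dots,s_t)$); $\Pi_{\sf S}\subset\Pi_{\sf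 H}$ is the set of stationary (possibly randomized) policies. For $\gamma\in(0,1)$, the discounted return is $$R_\gamma(\pi,\boldsymbol{P})=\mathbb{E}_{\pi,\boldsymbol{P}}\Big[\sum_{t=0}^{+\infty}\gamma^t r_{s_ta_ts_{t+1}}\ \Big|\ s_0\sim\boldsymbol{p}_0\Big],$$ where $\mathbb{E}_{\pi,\boldsymbol{P}}$ is expectation with respect to the law of $(s_t,a_t)_{t\ge 0}$ induced by $\pi$ and $\boldsymbol{P}$. A policy $\pi\in\Pi_{\sf H}$ is Blackwell optimal if there exists $\gamma_0\in(0,1)$ such that $\inf_{\boldsymbol{P}\in\mathcal{U}}R_\gamma(\pi,\boldsymbol{P})\ge\sup_{\pi'\in\Pi_{\sf H}}\inf_{\boldsymbol{P}\in\mathcal{U}}R_\gamma(\pi',\boldsymbol{P})$ for all $\gamma\in(\gamma_0,1)$. *)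

(* Defs.v *)
From HB Require Import structures.
From mathcomp Require Import all_boot all_order all_algebra.
From mathcomp Require Import all_classical all_reals all_analysis.

Set Implicit Arguments.
Unset Strict Implicit.
Unset Printing Implicit Defensive.

Import Order.TTheory GRing.Theory Num.Theory.
Import numFieldNormedType.Exports.

Local Open Scope classical_set_scope.
Local Open Scope ring_scope.

(* Finite nonempty types; the distinguished point only witnesses nonemptiness,
   which the library requires of the carrier of a measurable space. *)
#[short(type="pfinType")]
HB.structure Definition PointedFinite := {T of Finite T & Pointed T}.

HB.instance Definition _ (S A : pfinType) := Pointed.on (S * A)%type.

Definition simplex (R : realType) (T : finType) : set (T -> R) :=
  [set p | (forall x, 0 <= p x) /\ \sum_x p x = 1].

(* Infinite trajectories, with the sigma-algebra generated by the coordinates *)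
Definition coordinate_sets (X : pfinType) : set (set (nat -> X)) :=
  [set B | exists t x, B = [set w | w t = x]].

Definition trajectory (X : pfinType) := g_sigma_algebraType (@coordinate_sets X).

HB.instance Definition _ (X : pfinType) := Measurable.on (trajectory X).

(* mu is the law of a process whose next value, given that the values so far
   form the list h, has distribution q h. *)
Definition is_process_law (R : realType) (X : pfinType)
    (q : seq X -> X -> R) (mu : set (trajectory X) -> \bar R) :=
  forall (v : nat -> X) (n : nat),
    mu [set w | forall i, (i < n)%N -> w i = v i] =
    (\prod_(i < n) q (mkseq v i) (v i))%:E.

(* Existence of the law: the process is realized on [0, 1[ with the Lebesgue
   measure, by successively splitting intervals in proportions q h. Lists of
   past values are kept in reverse order. *)
Section process_law_exists.
Variables (R : realType) (X : pfinType) (q : seq X -> X -> R).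
Hypothesis simplexq : forall h, simplex (q h).

Let c h k := \sum_(i < k) q h (nth point (enum X) i).
Let cum h x := c h (index x (enum X)).

Let Fixpoint pw (r : seq X) : R :=
  if r is x :: r' then pw r' * q (rev r') x else 1.
Let Fixpoint lo (r : seq X) : R :=
  if r is x :: r' then lo r' + pw r' * cum (rev r') x else 0.
Let J r := [set u : R | lo r <= u < lo r + pw r].

Let q0 h x : 0 <= q h x. Proof. by have [+ _] := simplexq h; apply. Qed.

Let pw0 r : 0 <= pw r.
Proof. by elim: r => //= x r IH; rewrite mulr_ge0. Qed.

Let cS h k : c h k.+1 = c h k + q h (nth point (enum X) k).
Proof. by rewrite /c big_ord_recr. Qed.

Let cumS h x : c h (index x (enum X)).+1 = cum h x + q h x.
Proof. by rewrite cS nth_index// mem_enum. Qed.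

Let c_le h m n : (m <= n)%N -> c h m <= c h n.
Proof.
elim: n => [|n IH]; first by rewrite leqn0 => /eqP->.
rewrite leq_eqVlt => /orP[/eqP->//|]; rewrite ltnS => /IH /le_trans; apply.
by rewrite cS lerDl.
Qed.

Let c1 h : c h #|X| = 1.
Proof.
have [_ <-] := simplexq h.
rewrite /c -(big_mkord xpredT (fun k => q h (nth point (enum X) k))) cardE.
by rewrite -(big_nth point xpredT) big_enum.
Qed.

Let JE x r u : J (x :: r) u =
  (lo r + pw r * cum (rev r) x <= u <
   lo r + pw r * c (rev r) (index x (enum X)).+1).
Proof. by rewrite /J /= cumS mulrDr addrA. Qed.

Let J_cons x r : J (x :: r) `<=` J r.
Proof.
move=> u; rewrite JE => /andP[h1 h2]; apply/andP; split.
  apply: le_trans h1; rewrite lerDl mulr_ge0//.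
  by have := c_le (rev r) (leq0n (index x (enum X))); rewrite {1}/c big_ord0.
apply: (lt_le_trans h2); rewrite lerD2l -[leRHS]mulr1 ler_wpM2l//.
by rewrite -(c1 (rev r)) c_le// cardE index_mem mem_enum.
Qed.

Let J_sub r : J r `<=` J [::].
Proof. by elim: r => // x r IH; apply: subset_trans IH; exact: J_cons. Qed.

Let J_disj x y r u : J (x :: r) u -> J (y :: r) u -> x = y.
Proof.
have key x' y' : (index x' (enum X) < index y' (enum X))%N ->
    J (x' :: r) u -> J (y' :: r) u -> False.
  move=> xy; rewrite !JE => /andP[_ h2] /andP[h1 _].
  have := lt_le_trans (le_lt_trans h1 h2) (lexx _).
  by rewrite ltrD2l ltNge ler_wpM2l// c_le.
move=> Jx Jy; have [xy|yx|] := ltngtP (index x (enum X)) (index y (enum X)).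
- by case: (key _ _ xy).
- by case: (key _ _ yx).
- by move/(congr1 (nth point (enum X))); rewrite !nth_index ?mem_enum.
Qed.

Let J_split r u : J r u -> exists x, J (x :: r) u.
Proof.
move=> /andP[h1 h2]; pose p k := u < lo r + pw r * c (rev r) k.
have exp : exists k, p k by exists #|X|; rewrite /p c1 mulr1.
have [k pk kmin] := find_ex_minn exp.
case: k pk kmin => [|k] pk kmin.
  by move: pk; rewrite /p /c big_ord0 mulr0 addr0 ltNge h1.
have kX : (k < size (enum X))%N.
  by rewrite -cardE kmin// /p c1 mulr1.
exists (nth point (enum X) k); rewrite JE /cum index_uniq ?enum_uniq//.
apply/andP; split; last exact: pk.
by rewrite leNgt; apply/negP => /kmin; rewrite ltnn.
Qed.

Let child u r : X := xget point [set x | J (x :: r) u].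
Let Fixpoint path u n : seq X :=
  if n is n'.+1 then child u (path u n') :: path u n' else [::].
Let traj (u : measurableTypeR R) : trajectory X := fun n => child u (path u n).

Let childP u r : J r u -> J (child u r :: r) u.
Proof.
by move=> /J_split ex; exact: (xgetPex point (P := [set x | J (x :: r) u]) ex).
Qed.

Let J_path u n : J [::] u -> J (path u n) u.
Proof. by move=> Ju; elim: n => //= n; exact: childP. Qed.

Let path_J u r : J r u -> path u (size r) = r.
Proof.
elim: r => // x r IH Ju /=; have Jr := J_cons Ju.
by rewrite (IH Jr); congr cons; exact: (J_disj (childP Jr)).
Qed.

Let path_traj u n : path u n = rev (mkseq (traj u) n).
Proof. by elim: n => // n IH; rewrite mkseqS rev_rcons -IH. Qed.

Let cylE (v : nat -> X) n :
  J [::] `&` traj @^-1` [set w | forall i, (i < n)%N -> w i = v i] =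
  J (rev (mkseq v n)).
Proof.
apply/seteqP; split => [u [Ju /= uv]|u Jv].
  suff <- : path u n = rev (mkseq v n) by exact: J_path.
  rewrite path_traj; congr rev; apply/eq_in_map => i.
  by rewrite mem_iota => /andP[_ +]; exact: uv.
split; first exact: J_sub Jv.
move=> i i_n /=.
have := path_J Jv; rewrite size_rev size_mkseq path_traj.
move/(congr1 rev); rewrite !revK => /(congr1 (fun s => nth point s i)).
by rewrite !nth_mkseq.
Qed.

Let J_itv r : J r = `[lo r, lo r + pw r[%classic.
Proof. by rewrite set_itvE. Qed.

Let mJ r : measurable (J r : set (measurableTypeR R)). Proof. by rewrite J_itv. Qed.

Let traj_out u : ~ J [::] u -> traj u = fun=> point.
Proof.
move=> Ju; apply/funext => n; rewrite /traj /child; case: xgetP => //= x _ Jx.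
by case: Ju; exact: J_sub Jx.
Qed.

Let mtraj : measurable_fun (setT : set (measurableTypeR R)) traj.
Proof.
apply: (@measurability _ _ _ _ setT traj (@coordinate_sets X)) => //.
move=> _ [_ [t [x ->]] <-]; rewrite setTI.
rewrite (_ : traj @^-1` _ = (\bigcup_(r in [set: t.-tuple X]) J (x :: r)) `|`
    (~` J [::] `&` [set _ : R | point = x])); last first.
  apply/seteqP; split => [u /= ux|u /=].
    have [Ju|Ju] := pselect (J [::] u); last by right; split => //; rewrite -ux traj_out.
    have st : size (path u t) == t by rewrite path_traj size_rev size_mkseq.
    by left; exists (Tuple st) => //=; rewrite -ux; exact: (@J_path u t.+1).
  move=> [[r /= _ Ju]|[Ju <-]]; last by rewrite traj_out.
  by have := path_J Ju; rewrite /= size_tuple => -[].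
apply: measurableU.
  by apply: fin_bigcup_measurable => [|r _]; [exact: finite_finset|exact: mJ].
apply: measurableI; first by apply: measurableC; exact: mJ.
have [->|px] := eqVneq (point : X) x.
  by rewrite (_ : [set _ | _] = setT)//; apply/seteqP; split.
rewrite (_ : [set _ | _] = set0)//; apply/seteqP; split => // u /= /eqP.
by rewrite (negbTE px).
Qed.

Let leb : set (measurableTypeR R) -> \bar R :=
  mrestr (@lebesgue_measure R) (mJ [::]).
HB.instance Definition _ := Measure.on leb.

Let leb1 : leb setT = 1%E.
Proof.
rewrite /leb /mrestr setTI J_itv lebesgue_measure_itv/= add0r lte_fin ltr01.
by rewrite oppr0 adde0.
Qed.

Lemma process_law_exists :
  exists mu : probability (trajectory X) R, is_process_law q mu.
Proof.
pose P : probability (measurableTypeR R) R :=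
  HB.pack leb (Measure_isProbability.Build _ _ _ leb leb1).
pose T : {mfun measurableTypeR R >-> trajectory X} :=
  HB.pack traj (isMeasurableFun.Build _ _ _ _ traj mtraj).
exists (distribution P T) => v n.
rewrite /distribution /pushforward /= /leb /mrestr setIC cylE J_itv.
rewrite lebesgue_measure_itv/= lte_fin ltrDl.
have -> : \prod_(i < n) q (mkseq v i) (v i) = pw (rev (mkseq v n)).
  elim: n => [|n IH]; first by rewrite big_ord0.
  by rewrite big_ord_recr /= mkseqS rev_rcons /= revK IH.
case: ifPn => [_|]; first by rewrite -EFinD addrAC subrr add0r.
by rewrite -leNgt => pwle0; congr EFin; apply/eqP; rewrite eq_le pwle0 pw0.
Qed.

End process_law_exists.

(* A choice of law, unique because cylinders generate the sigma-algebra *)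
Definition process_law (R : realType) (X : pfinType) (q : seq X -> X -> R)
    (hq : forall h, simplex (q h)) : probability (trajectory X) R :=
  sval (cid (process_law_exists hq)).

Lemma process_lawP (R : realType) (X : pfinType) (q : seq X -> X -> R)
  (hq : forall h, simplex (q h)) : is_process_law q (process_law hq).
Proof. exact: (svalP (cid (process_law_exists hq))). Qed.

Section rmdp.
Variables (R : realType) (S A : pfinType).

(* P s a s' is the probability of moving to s' when a is played in s. *)
Definition stochastic (P : S -> A -> S -> R) := forall s a, simplex (P s a).

Record transition_kernel := TransitionKernel {
  transition_fun :> S -> A -> S -> R;
  transition_kernelP : stochastic transition_fun }.

Record rmdp := RMDP {
  reward : S -> A -> S -> R;
  uncertainty : set (S -> A -> S -> R);
  init : S -> R;
  uncertainty_stochastic : uncertainty `<=` stochastic;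
  uncertainty_nonempty : uncertainty !=set0;
  uncertainty_compact :
    compact (uncertainty : set {ptws S -> {ptws A -> {ptws S -> R}}});
  initP : simplex init }.

(* pi h s is the distribution of a_t when h = [:: (s_0, a_0); ...;
   (s_(t-1), a_(t-1))] and s_t = s. *)
Record policy := Policy {
  policy_fun :> seq (S * A) -> S -> A -> R;
  policyP : forall h s, simplex (policy_fun h s) }.

Definition stationary (pi : policy) :=
  exists f : S -> A -> R, forall h s, pi h s = f s.

Definition sa_rectangular (M : rmdp) :=
  exists2 V : S -> A -> set (S -> R),
    (forall s a, V s a `<=` simplex (T := S)) &
    uncertainty M = [set P | forall s a, V s a (P s a)].

(* R^o only gives the functions their vector space structure. *)
Definition convex_uncertainty (M : rmdp) :=
  convex_set (M := S -> A -> S -> R^o) (uncertainty M).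

(* Distribution of (s_t, a_t) given (s_0, a_0), ..., (s_(t-1), a_(t-1)) *)
Definition state_action_step (M : rmdp) (pi : policy) (P : transition_kernel)
    (h : seq (S * A)) (x : S * A) : R :=
  (if h is y :: h' then P (last y h').1 (last y h').2 x.1 else init M x.1)
  * pi h x.1 x.2.

Lemma state_action_stepP (M : rmdp) (pi : policy) (P : transition_kernel) h :
  simplex (T := (S * A)%type) (state_action_step M pi P h).
Proof.
pose p := if h is y :: h' then P (last y h').1 (last y h').2 else init M.
have [p0 p1] : simplex p.
  by rewrite /p; case: h {p} => [|y h']; [exact: initP|exact: transition_kernelP].
have stepE x : state_action_step M pi P h x = p x.1 * pi h x.1 x.2.
  by rewrite /p /state_action_step; case: (h).
split=> [x|].
  by rewrite stepE mulr_ge0//; have [+ _] := policyP pi h x.1; exact.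
under eq_bigr do rewrite stepE.
rewrite -(pair_bigA _ (fun s a => p s * pi h s a))/= -p1.
by apply: eq_bigr => s _; rewrite -mulr_sumr (policyP pi h s).2 mulr1.
Qed.

Definition trajectory_law (M : rmdp) (pi : policy) (P : transition_kernel) :=
  process_law (X := (S * A)%type) (@state_action_stepP M pi P).

Definition discounted_reward (M : rmdp) (gamma : R)
    (w : trajectory (S * A)%type) : R :=
  limn (series (fun t => gamma ^+ t * reward M (w t).1 (w t).2 (w t.+1).1)).

Definition discounted_return (M : rmdp) (gamma : R) (pi : policy)
    (P : transition_kernel) : \bar R :=
  'E_(trajectory_law M pi P)[discounted_reward M gamma].

Definition worst_return (M : rmdp) (gamma : R) (pi : policy) : \bar R :=
  ereal_inf [set discounted_return M gamma pi P |
             P in [set P : transition_kernel | uncertainty M P]].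

Definition blackwell_optimal (M : rmdp) (pi : policy) :=
  exists2 gamma0 : R, 0 < gamma0 < 1 &
    forall gamma, gamma0 < gamma < 1 ->
      (ereal_sup [set worst_return M gamma pi' | pi' in [set: policy]]
         <= worst_return M gamma pi)%E.

End rmdp.

(* Main.v *)
(* From [start], action [a] leads to absorbing states with probabilities
   x = p gain and y = p loss, and the normalized return is x - (1 - gamma) y.
   Nature picks (x, y) in the convex set above the tangents to the parabola
   x = y^2 at the points y = tangency a n.  When 1 - gamma = 2 * tangency a m,
   the line of slope 1 - gamma touches the parabola at y = tangency a m: this
   tangent bounds the set of action [a], whereas the set of the other action
   sticks out below it, so [a] is strictly better.  The tangency points of the
   two actions alternate and tend to 0, so each action is strictly better than
   the other for discount factors arbitrarily close to 1.  A policy matters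
   only through its first action, hence no policy can be optimal for all such
   discount factors. *)
Require Import Defs.
From HB Require Import structures.
From mathcomp Require Import all_boot all_order all_algebra.
From mathcomp Require Import all_classical all_reals all_analysis.
From mathcomp Require Import measurable_realfun ring lra.

Import Order.TTheory GRing.Theory Num.Theory.
Import numFieldNormedType.Exports.

Local Open Scope classical_set_scope.
Local Open Scope ring_scope.

(** * Integration against the law of a process *)

Section process_law_theory.
Variables (R : realType) (X : pfinType) (q : seq X -> X -> R).
Variable mu : probability (trajectory X) R.
Hypothesis muq : is_process_law q mu.

Lemma measurable_coordinate t x : measurable [set w : trajectory X | w t = x].
Proof. by apply: sub_sigma_algebra; exists t, x. Qed.

Lemma measurable_cylinder (v : nat -> X) n :
  measurable [set w : trajectory X | forall i, (i < n)%N -> w i = v i].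
Proof.
rewrite (_ : [set w : trajectory X | _] =
    \bigcap_i (if (i < n)%N then [set w : trajectory X | w i = v i] else setT)).
  apply: bigcapT_measurable => i.
  by case: ifP => _; [exact: measurable_coordinate|exact: measurableT].
apply/seteqP; split=> [w wv i _|w wv i ilt]; last by have := wv i I; rewrite ilt.
by case: ifP => // /wv.
Qed.

(** There are only countably many finite histories, and each cylinder that ends with a step of
    probability zero is null. *)
Lemma process_law_ae : {ae mu, forall w, forall t, q (mkseq w t) (w t) != 0}.
Proof.
pose cyl (z : seq X * X) := [set w : trajectory X |
  forall i, (i < (size z.1).+1)%N -> w i = nth point (rcons z.1 z.2) i].
(* Pickling enumerates the pairs (history, next value); only the pairs of probability zero
   contribute a cylinder. *)
pose F k := if unpickle k is Some z then
    if q z.1 z.2 == 0 then cyl z else set0 else set0.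
apply: (@negligibleS _ _ _ _ (\bigcup_k F k)); last first.
  apply: negligible_bigcup => k; rewrite /F.
  case: unpickle => [[h x]|]; last exact: negligible_set0.
  case: eqP => [/= q0|_]; last exact: negligible_set0.
  exists (cyl (h, x)); split => //; first exact: measurable_cylinder.
  rewrite [mu _]muq big_ord_recr/= nth_rcons ltnn eqxx.
  rewrite (_ : mkseq _ _ = h) ?q0 ?mulr0//.
  apply: (@eq_from_nth _ point) => [|i]; rewrite size_mkseq// => ih.
  by rewrite nth_mkseq// nth_rcons ih.
move=> w /= /existsNP[t /negP]; rewrite negbK => q0.
exists (pickle (mkseq w t, w t)) => //; rewrite /F pickleK /= q0 /cyl/=.
rewrite size_mkseq => i; rewrite ltnS -mkseqS => it.
by rewrite nth_mkseq.
Qed.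

Let pair_event s t (z : X * X) :=
  [set w : trajectory X | w s = z.1] `&` [set w : trajectory X | w t = z.2].

Let measurable_pair_event s t z : measurable (pair_event s t z).
Proof. by apply: measurableI; exact: measurable_coordinate. Qed.

Let pairE s t (g : X -> X -> R) (w : trajectory X) :
  g (w s) (w t) = \sum_z g z.1 z.2 * \1_(pair_event s t z) w.
Proof.
rewrite (bigD1 (w s, w t))//= big1 ?addr0 => [|z zw].
  by rewrite indicE mem_set ?mulr1.
rewrite indicE memNset ?mulr0// => -[/= ws wt].
by case/eqP: zw; rewrite ws wt -surjective_pairing.
Qed.

Lemma measurable_coordinate_pair s t (g : X -> X -> R) :
  measurable_fun setT (fun w : trajectory X => g (w s) (w t)).
Proof.
rewrite (_ : (fun w => _) =
    fun w => \sum_z g z.1 z.2 * \1_(pair_event s t z) w); last first.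
  by apply/funext => w; exact: pairE.
apply: measurable_sum => z; apply: measurable_funM; first exact: measurable_cst.
exact: measurable_indic.
Qed.

Lemma integral_first_two (g : X -> X -> R) :
  (\int[mu]_w (g (w 0) (w 1))%:E =
   (\sum_x \sum_y q [::] x * q [:: x] y * g x y)%:E)%E.
Proof.
under eq_integral do rewrite (pairE 0 1) -sumEFin.
have int_event z : mu.-integrable setT
    (fun w => (g z.1 z.2 * \1_(pair_event 0 1 z) w)%:E).
  have ind := integrable_indic mu (measurable_pair_event 0 1 z).
  exact: (integrableZl measurableT (g z.1 z.2) ind).
rewrite integral_sum//= pair_bigA/= -sumEFin; apply: eq_bigr => -[x y] _.
under eq_integral do rewrite EFinM.
rewrite integralZl//; last exact: integrable_indic.
rewrite integral_indic// setIT mulrC EFinM; congr (_ * _)%E.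
have := muq (fun i => if i is 0 then x else y) 2.
rewrite !big_ord_recr big_ord0/= mul1r => <-; congr (mu _).
apply/seteqP; split=> [w [/= wx wy] [|[|]]//|w wv].
by split; [exact: (wv 0)|exact: (wv 1)].
Qed.

(** Serves for an infinite series [f] that collapses to a function of two coordinates only along
    paths whose steps all have nonzero probability. *)
Lemma integral_ae_first_two (f : trajectory X -> R) (g : X -> X -> R) :
  measurable_fun setT f ->
  (forall w, (forall t, q (mkseq w t) (w t) != 0) -> f w = g (w 0) (w 1)) ->
  (\int[mu]_w (f w)%:E =
   (\sum_x \sum_y q [::] x * q [:: x] y * g x y)%:E)%E.
Proof.
move=> mf fg; rewrite -integral_first_two; apply: ae_eq_integral => //.
- exact/measurable_EFinP.
- by apply/measurable_EFinP; exact: measurable_coordinate_pair.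
- apply: (negligibleS _ process_law_ae) => w /= fg_neq supp.
  by apply: fg_neq => _; rewrite fg.
Qed.

End process_law_theory.

(** * Continuity and compactness for pointwise convergence *)

Lemma continuous_ptws_eval (T : eqType) (U : topologicalType) (x : T) :
  continuous (fun f : {ptws T -> U} => f x).
Proof. exact: (@proj_continuous T (fun=> U) x). Qed.

Lemma continuous_lincomb (R : realType) (T : topologicalType) (f g : T -> R)
    (c d : R) : continuous f -> continuous g ->
  continuous (fun x => c * f x - d * g x).
Proof.
move=> cf cg x; apply: (cvgB (f := fun x => c * f x) (g := fun x => d * g x)).
  by apply: (cvgM (f := cst c)); [exact: cvg_cst|exact: cf].
by apply: (cvgM (f := cst d)); [exact: cvg_cst|exact: cg].
Qed.

(** A closed subset of the cube with sides [0, 1], which is compact by Tychonoff. *)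
Lemma compact_simplex (R : realType) (T : finType) :
  compact (@simplex R T : set {ptws T -> R}).
Proof.
apply: (@subclosed_compact {ptws T -> R} _
  [set f | forall x, `[0, 1]%classic (f x)]).
- rewrite (_ : @simplex R T =
      (\bigcap_x [set p : {ptws T -> R} | 0 <= p x]) `&`
      [set p : {ptws T -> R} | \sum_x p x = 1]); last first.
    by apply/seteqP; split=> p [p0 p1]; split=> // x; [move=> _|]; exact: p0.
  apply: closedI.
    apply: closed_bigI => x _.
    apply: (@closed_comp _ _ _ [set y : R | 0 <= y]); last exact: closed_ge.
    by move=> p _; exact: continuous_ptws_eval.
  apply: (@closed_comp {ptws T -> R} R (fun p => \sum_x p x) [set y | y = 1]).
    move=> p _; apply: continuous_big => [|x _]; first exact: add_continuous.
    exact: continuous_ptws_eval.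
  exact: closed_eq.
- by apply: (@tychonoff T (fun=> R) (fun=> `[0, 1]%classic)) => x; exact: segment_compact.
- move=> p [p0 p1] x /=; rewrite in_itv/= p0 -p1 (bigD1 x)//= lerDl.
  by apply: sumr_ge0.
Qed.

Lemma compact_rectangular (R : realType) (S A : pfinType)
    (V : S -> A -> set {ptws S -> R}) : (forall s a, compact (V s a)) ->
  compact ([set P | forall s a, V s a (P s a)]
    : set {ptws S -> {ptws A -> {ptws S -> R}}}).
Proof.
move=> cV; apply: (@tychonoff S (fun=> {ptws A -> {ptws S -> R}})
  (fun s => [set f | forall a, V s a (f a)])) => s.
exact: (@tychonoff A (fun=> {ptws S -> R}) (V s)).
Qed.

(** * Convergence and measurability of the discounted reward *)

Section discounted_reward_theory.
Variables (R : realType) (S A : pfinType) (M : rmdp R S A) (gamma : R).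
Hypothesis gamma01 : 0 < gamma < 1.

Lemma cvgn_discounted_reward (w : trajectory (S * A)%type) : cvgn (series
  (fun t => gamma ^+ t * reward M (w t).1 (w t).2 (w t.+1).1)).
Proof.
have [g0 g1] := andP gamma01.
(* A crude uniform bound on the rewards, so that a geometric series dominates. *)
pose K := \sum_(z : S * A * S) `|reward M z.1.1 z.1.2 z.2|.
have rK s a s' : `|reward M s a s'| <= K.
  by rewrite /K (bigD1 (s, a, s'))//= lerDl sumr_ge0.
apply: normed_cvg; apply: (@series_le_cvg _ _ (geometric K gamma)).
- by move=> n; exact: normr_ge0.
- by move=> n; rewrite /geometric/= mulr_ge0 ?exprn_ge0 ?(ltW g0)// sumr_ge0.
- move=> n; rewrite /geometric/= normrM ger0_norm ?exprn_ge0 ?(ltW g0)//.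
  by rewrite mulrC ler_wpM2r ?exprn_ge0 ?(ltW g0).
- by apply: is_cvg_geometric_series; rewrite ger0_norm ?ltW.
Qed.

Lemma measurable_discounted_reward :
  measurable_fun setT (discounted_reward M gamma).
Proof.
apply: (measurable_fun_cvg (h := fun n (w : trajectory (S * A)%type) => series
  (fun t => gamma ^+ t * reward M (w t).1 (w t).2 (w t.+1).1) n)); last first.
  by move=> w _; exact: cvgn_discounted_reward.
move=> n; rewrite /series/=; apply: measurable_sum => t.
apply: measurable_funM; first exact: measurable_cst.
exact: (measurable_coordinate_pair R _ t t.+1 (fun x y => reward M x.1 x.2 y.1)).
Qed.

End discounted_reward_theory.

(** * The four-state robust MDP *)

HB.saturate bool.

Definition state : pfinType := (bool * bool)%type.
Definition start : state := (false, false).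
Definition idle : state := (false, true).
Definition gain : state := (true, false).
Definition loss : state := (true, true).

Lemma sum_state (R : realType) (F : state -> R) :
  \sum_s F s = F start + F idle + F gain + F loss.
Proof.
transitivity (\sum_(i : bool) \sum_(j : bool) F (i, j)).
  by rewrite pair_bigA; apply: eq_bigr => -[].
by rewrite !big_bool/= addrC [F (_, _) + _]addrC [F (true, _) + _]addrC addrA.
Qed.

Lemma simplex_support (R : realType) (T : finType) (p : T -> R) x y :
  simplex p -> p x = 1 -> p y != 0 -> y = x.
Proof.
move=> [p0 p1] px; apply: contra_neq_eq => yx.
move: p1; rewrite (bigD1 x)//= (bigD1 y)//= px => p1.
apply/eqP; rewrite eq_le p0 andbT.
have : 0 <= \sum_(i | (i != x) && (i != y)) p i by apply: sumr_ge0.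
by move: p1; lra.
Qed.

Lemma limn_series_first (R : realType) (u : R^nat) :
  (forall t, u t.+1 = 0) -> limn (series u) = u 0.
Proof.
move=> u0; apply: cvg_lim => //; rewrite -(cvg_shiftS (series u)).
rewrite (_ : [sequence _]_ _ = cst (u 0)); first exact: cvg_cst.
by apply/funext => n /=; rewrite /series/= big_nat_recl// big1 ?addr0.
Qed.

Section oscillating_rmdp.
Variable R : realType.

(** [gain] pays 1 in every period, on entry and on each self-loop; [loss] costs 1 only once, on
    entry from [start]. *)
Definition oscillating_reward (s : state) (a : bool) (s' : state) : R :=
  if s' == gain then 1 else if (s == start) && (s' == loss) then -1 else 0.

(* Powers of 1/2, with even exponents for one action and odd ones for the other. *)
Definition tangency (a : bool) (n : nat) : R := 2^-1 ^+ (n.*2 + a).+2.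

Definition above_tangents (a : bool) : set (state -> R) :=
  [set p | forall n,
     2 * tangency a n * p loss - tangency a n ^+ 2 <= p gain].

(** [p start = 0] makes the process leave [start] at once, so that a policy acts only through its
    first action. *)
Definition oscillating_set (s : state) (a : bool) : set (state -> R) :=
  @simplex R state `&`
  [set p | if s == start then p start = 0 /\ above_tangents a p else p s = 1].

(** The mass left over goes to [idle], which pays nothing, so [x] and [y] can vary independently. *)
Definition lottery (x y : R) (s : state) : R :=
  if s == gain then x else if s == loss then y else
  if s == idle then 1 - x - y else 0.

Lemma lottery_oscillating_set x y a : 0 <= x -> 0 <= y -> x + y <= 1 ->
  (forall n, 2 * tangency a n * y - tangency a n ^+ 2 <= x) ->
  oscillating_set start a (lottery x y).
Proof.
move=> x0 y0 xy tan; split; last by split.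
split=> [[[] []]|]; rewrite ?sum_state /lottery/=; lra.
Qed.

(* Nature plays [p a] against action [a]; the other states are absorbing. *)
Definition branching (p : bool -> state -> R) (s : state) (a : bool) : state -> R :=
  if s == start then p a else fun s' => (s' == s)%:R.

Lemma branching_oscillating_set p : (forall a, oscillating_set start a (p a)) ->
  forall s a, oscillating_set s a (branching p s a).
Proof.
move=> ps s a; rewrite /branching; have [->//|s0] := eqVneq s start.
split; last by rewrite /= (negbTE s0) eqxx.
split=> [s'|]; first exact: ler0n.
rewrite (bigD1 s)//= eqxx big1 ?addr0// => s' /negbTE.
by move=> ->.
Qed.

Definition oscillating_uncertainty : set (state -> bool -> state -> R) :=
  [set P | forall s a, oscillating_set s a (P s a)].

Lemma oscillating_uncertainty_stochastic :
  oscillating_uncertainty `<=` @stochastic R state bool.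
Proof. by move=> P UP s a; have [] := UP s a. Qed.

Lemma oscillating_uncertainty_nonempty : oscillating_uncertainty !=set0.
Proof.
(* The origin lies above every tangent, whose height there is minus a square. *)
exists (branching (fun=> lottery 0 0)); apply: branching_oscillating_set => a.
apply: lottery_oscillating_set; rewrite ?addr0 ?ler01// => n.
by rewrite mulr0 sub0r oppr_le0 sqr_ge0.
Qed.

Lemma compact_oscillating_set s a :
  compact (oscillating_set s a : set {ptws state -> R}).
Proof.
apply: compact_closedI; first exact: compact_simplex.
have ev x (B : set R) : closed B -> closed [set p : {ptws state -> R} | B (p x)].
  move=> cB; apply: (@closed_comp _ _ _ B) => // p _.
  exact: continuous_ptws_eval.
case: (s == start); last by apply: (ev s [set y | y = 1]); exact: closed_eq.
apply: closedI; first by apply: (ev start [set y | y = 0]); exact: closed_eq.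
(* An intersection of closed half-spaces; the factor 1 fits the form of [continuous_lincomb]. *)
rewrite (_ : above_tangents a = \bigcap_n [set p : {ptws state -> R} |
    2 * tangency a n * p loss - 1 * p gain <= tangency a n ^+ 2]); last first.
  by apply/seteqP; split=> [p tan n _|p tan n]; [have := tan n|have := tan n I];
    rewrite /= mul1r !lerBlDr addrC.
apply: closed_bigI => n _.
apply: (@closed_comp {ptws state -> R} R
    (fun p => 2 * tangency a n * p loss - 1 * p gain)
    [set y | y <= tangency a n ^+ 2]); last exact: closed_le.
by move=> p _; apply: (@continuous_lincomb R {ptws state -> R});
  exact: continuous_ptws_eval.
Qed.

Lemma oscillating_uncertainty_compact : compact (oscillating_uncertainty :
  set {ptws state -> {ptws bool -> {ptws state -> R}}}).
Proof. exact: (compact_rectangular _ _ _ _ compact_oscillating_set). Qed.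

Lemma simplex_start : simplex (fun s : state => (s == start)%:R : R).
Proof.
split=> [s|]; first exact: ler0n.
by rewrite sum_state/= !addr0.
Qed.

Definition oscillating_rmdp : rmdp R state bool :=
  RMDP oscillating_reward oscillating_uncertainty_stochastic
    oscillating_uncertainty_nonempty oscillating_uncertainty_compact
    simplex_start.

Lemma oscillating_rmdp_rectangular : sa_rectangular oscillating_rmdp.
Proof. by exists oscillating_set => // s a p []. Qed.

Lemma oscillating_rmdp_convex : convex_uncertainty oscillating_rmdp.
Proof.
move=> P Q k /set_mem UP /set_mem UQ; apply/mem_set => s a.
have [[P0 P1] Pc] := UP s a; have [[Q0 Q1] Qc] := UQ s a.
set PQ := (X in oscillating_set s a X).
have [l [l0 l1 PQE]] : exists l : R, [/\ 0 <= l, l <= 1 &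
    forall s', PQ s' = l * P s a s' + (1 - l) * Q s a s'].
  by exists k%:num; split; [exact: ge0|exact: le1|].
split; first split.
- move=> s'; rewrite PQE; have l10 : 0 <= 1 - l by rewrite subr_ge0.
  exact: addr_ge0 (mulr_ge0 l0 (P0 s')) (mulr_ge0 l10 (Q0 s')).
- under eq_bigr do rewrite PQE.
  by rewrite big_split/= -!mulr_sumr P1 Q1; lra.
- move: Pc Qc => /=; case: ifP => _; rewrite !PQE; last by move=> -> ->; lra.
  move=> [-> Pt] [-> Qt]; split=> [|n]; first by lra.
  rewrite !PQE; have := Pt n; have := Qt n; nra.
Qed.

End oscillating_rmdp.

(** * Returns in closed form and existence of a worst kernel *)

Section oscillating_return.
Variable R : realType.
Notation M := (oscillating_rmdp R).

Lemma state_action_step_rcons (pi : policy R state bool)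
    (P : transition_kernel R state bool) (w : nat -> state * bool) t x :
  state_action_step M pi P (mkseq w t.+1) x =
  P (w t).1 (w t).2 x.1 * pi (mkseq w t.+1) x.1 x.2.
Proof.
have : last (w 0) (mkseq w t.+1) = w t by rewrite mkseqS last_rcons.
by rewrite /state_action_step; case: (mkseq w t.+1) (size_mkseq w t.+1) => //= y h _ ->.
Qed.

(** The total discounted reward of a path that jumps from [start] to [s] and stays there. *)
Definition payoff (gamma : R) (s : state) : R :=
  if s == gain then (1 - gamma)^-1 else if s == loss then -1 else 0.

(* A path of positive probability leaves [start] at time 1 and its state is
   constant from then on. *)
Lemma discounted_reward_supported (pi : policy R state bool)
    (P : transition_kernel R state bool) (gamma : R) (w : trajectory (state * bool)%type) :
  oscillating_uncertainty R P -> 0 < gamma < 1 ->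
  (forall t, state_action_step M pi P (mkseq w t) (w t) != 0) ->
  discounted_reward M gamma w = payoff gamma (w 1).1.
Proof.
move=> UP /andP[g0 g1] q_neq0.
have w0 : (w 0).1 = start.
  have := q_neq0 0; rewrite /state_action_step/= mulf_eq0 negb_or => /andP[+ _].
  by case: ((w 0).1 =P start) => //; rewrite eqxx.
have trans t : P (w t).1 (w t).2 (w t.+1).1 != 0.
  by have := q_neq0 t.+1; rewrite state_action_step_rcons mulf_eq0 negb_or => /andP[].
have w1 : (w 1).1 != start.
  apply: contra_neq (trans 0) => ->.
  by have [_] := UP (w 0).1 (w 0).2; rewrite w0 => -[].
have wS t : (w t.+1).1 = (w 1).1.
  elim: t => // t IH; rewrite -IH.
  have [simP] := UP (w t.+1).1 (w t.+1).2; rewrite /= {1}IH (negbTE w1) => P1.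
  exact: simplex_support simP P1 (trans t.+1).
rewrite /discounted_reward /payoff; have [w1g|w1g] := eqVneq (w 1).1 gain.
  rewrite (_ : (fun t => _) = geometric 1 gamma); last first.
    apply/funext => t.
    by rewrite /geometric/= /oscillating_reward wS w1g eqxx mulr1 mul1r.
  have := @cvg_geometric_series R 1 gamma; rewrite ger0_norm ?(ltW g0)// div1r.
  by move=> /(_ g1) /cvg_lim; exact.
(* Outside [gain], only the transition at time 0 can carry a reward. *)
rewrite limn_series_first => [|t] /=.
  by rewrite expr0 mul1r /oscillating_reward (negbTE w1g) w0 eqxx.
rewrite /oscillating_reward !wS (negbTE w1g) (negbTE w1)/= mulr0.
by [].
Qed.

Lemma oscillating_return (pi : policy R state bool)
    (P : transition_kernel R state bool) (gamma : R) :
  oscillating_uncertainty R P -> 0 < gamma < 1 ->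
  discounted_return M gamma pi P =
  (\sum_a pi [::] start a * (P start a gain / (1 - gamma) - P start a loss))%:E.
Proof.
move=> UP g01; rewrite /discounted_return unlock.
rewrite (integral_ae_first_two _ _ _ _ (process_lawP (@state_action_stepP _ _ _ M pi P))
  _ (fun _ y => payoff gamma y.1)); first last.
- by move=> w; exact: discounted_reward_supported.
- exact: measurable_discounted_reward.
congr EFin.
have stepE x : \sum_y state_action_step M pi P [::] x *
    state_action_step M pi P [:: x] y * payoff gamma y.1 =
    (x.1 == start)%:R * pi [::] x.1 x.2 *
    (P x.1 x.2 gain / (1 - gamma) - P x.1 x.2 loss).
  transitivity (\sum_s \sum_a (x.1 == start)%:R * pi [::] x.1 x.2 *
      (P x.1 x.2 s * payoff gamma s) * pi [:: x] s a).
    rewrite pair_bigA; apply: eq_bigr => -[s a] _.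
    by rewrite /state_action_step/=; ring.
  (* The payoff does not depend on the second action, whose probabilities sum to 1. *)
  under eq_bigr do rewrite -mulr_sumr (policyP pi _ _).2 mulr1.
  rewrite -mulr_sumr sum_state /payoff/=; congr (_ * _).
  by ring.
under eq_bigr do rewrite stepE.
rewrite -(pair_bigA _ (fun s a => (s == start)%:R * pi [::] s a *
    (P s a gain / (1 - gamma) - P s a loss)))/=.
rewrite (bigD1 start)//= [X in _ + X]big1 => [|s /negbTE ->].
  by rewrite addr0; apply: eq_bigr => a _; rewrite mul1r.
by apply: big1 => a _; rewrite !mul0r.
Qed.

(** By the closed form, the return is continuous in the kernel, and the uncertainty set is compact
    and nonempty. *)
Lemma worst_return_attained (pi : policy R state bool) (gamma : R) :
  0 < gamma < 1 ->
  exists2 P : transition_kernel R state bool, oscillating_uncertainty R P &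
    discounted_return M gamma pi P = worst_return M gamma pi.
Proof.
move=> g01.
(* The closed form makes sense for all arrays, stochastic or not, so continuity can be proved on the
   whole product space. *)
pose f (P : {ptws state -> {ptws bool -> {ptws state -> R}}}) : R :=
  \sum_a ((pi [::] start a / (1 - gamma)) * P start a gain -
          pi [::] start a * P start a loss).
have evc a s : continuous
    (fun P : {ptws state -> {ptws bool -> {ptws state -> R}}} => P start a s).
  move=> P; apply: (@continuous_comp {ptws state -> {ptws bool -> {ptws state -> R}}}
    {ptws bool -> {ptws state -> R}} R (fun P => P start) (fun h => h a s)).
    exact: continuous_ptws_eval.
  apply: (@continuous_comp {ptws bool -> {ptws state -> R}} {ptws state -> R} R
    (fun h => h a) (fun p => p s)); exact: continuous_ptws_eval.
have fc : continuous f.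
  apply: continuous_big => [|a _]; first exact: add_continuous.
  exact: continuous_lincomb.
have fE (P : transition_kernel R state bool) : oscillating_uncertainty R P ->
    discounted_return M gamma pi P = (f P)%:E.
  move=> UP; rewrite oscillating_return//; congr EFin.
  by apply: eq_bigr => a _; rewrite mulrBr mulrA mulrAC.
have [P /set_mem UP Pmin] := @compact_EVT_min
  {ptws state -> {ptws bool -> {ptws state -> R}}} R f _
  (oscillating_uncertainty_nonempty R) (oscillating_uncertainty_compact R)
  (continuous_subspaceT fc).
pose K := TransitionKernel (oscillating_uncertainty_stochastic R P UP).
exists K => //; apply/eqP; rewrite eq_le; apply/andP; split.
  apply: le_ereal_inf_tmp => _ [Q UQ <-].
  by rewrite !fE// lee_fin; apply: Pmin; exact: mem_set.
by apply: ereal_inf_lbound; exists K.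
Qed.

(** * Size and separation of the tangency points *)

Lemma tangency_gt0 a n : 0 < tangency R a n.
Proof. by rewrite exprn_gt0// invr_gt0. Qed.

(** Distinct powers of 1/2 have a ratio r with r <= 1/2 or r >= 2, so 2 r - r^2 = 1 - (1 - r)^2 is
    at most 3/4. *)
Lemma exprV2_gap (i j : nat) : i != j ->
  2 * 2^-1 ^+ i * 2^-1 ^+ j - (2^-1 ^+ i) ^+ 2 <= 3 / 4 * (2^-1 ^+ j) ^+ 2 :> R.
Proof.
have half k l : (k < l)%N -> 2^-1 ^+ l <= 2^-1 * 2^-1 ^+ k :> R.
  move=> kl; rewrite -exprS; apply: ler_wiXn2l => //; lra.
have pos k : 0 < 2^-1 ^+ k :> R by rewrite exprn_gt0// invr_gt0.
have [ij _|ji _|//] := ltngtP i j.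
- by have := half _ _ ij; have := pos i; have := pos j; nra.
- by have := half _ _ ji; have := pos i; have := pos j; nra.
Qed.

(* At y = tangency a m, the tangents of the other action leave a gap of at
   least y^2 / 4 below the parabola. *)
Lemma tangency_gap a m n :
  2 * tangency R (~~ a) n * tangency R a m - tangency R (~~ a) n ^+ 2 <=
  3 / 4 * tangency R a m ^+ 2.
Proof.
(* The exponents of the two actions differ in parity. *)
apply: exprV2_gap; rewrite !eqSS; apply/eqP => /(congr1 odd).
by rewrite !oddD !odd_double; case: a.
Qed.

(** With t <= 1/4, the discount factor 1 - 2 t lies in (0, 1), and the masses t^2 and t fit into one
    distribution. *)
Lemma tangency_le a n : tangency R a n <= 1 / 4.
Proof.
rewrite /tangency !exprS mulrA.
have : 2^-1 ^+ (n.*2 + a) <= 1 :> R by rewrite exprn_ile1//; lra.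
lra.
Qed.

Lemma tangency_small (e : R) a : 0 < e -> exists n, 2 * tangency R a n < e.
Proof.
move=> e0; exists (Num.bound e^-1); set n := Num.bound _.
have en : e^-1 < 2 ^+ n.
  apply: (lt_trans (archi_boundP _)); first by rewrite invr_ge0 ltW.
  by rewrite -natrX ltr_nat ltn_expl.
have ne : 2^-1 ^+ n < e by rewrite exprVn invf_plt ?posrE// exprn_gt0.
apply: le_lt_trans ne; rewrite /tangency exprS mulrA divff// mul1r.
by apply: ler_wiXn2l; [lra|lra|rewrite -addnn -addnA -addnS leq_addr].
Qed.

(** * Comparison of an arbitrary policy with a constant one *)

Definition always (b : bool) : policy R state bool.
Proof.
exists (fun _ _ a => (a == b)%:R) => h s; split=> [a|]; first exact: ler0n.
by rewrite big_bool; case: b; rewrite /= ?addr0 ?add0r.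
Defined.

Lemma always_stationary b : stationary (always b).
Proof. by exists (fun _ a => (a == b)%:R). Qed.

(** With 1 - gamma = 2 t, the tangent at t gives x - 2 t y >= - t^2; dividing by 2 t yields the
    bound. *)
Lemma worst_return_always_ge a m :
  ((- (tangency R a m / 2))%:E <=
   worst_return M (1 - 2 * tangency R a m) (always a))%E.
Proof.
have t0 := tangency_gt0 a m; have t1 := tangency_le a m.
apply: le_ereal_inf_tmp => _ [P UP <-].
rewrite oscillating_return; [|exact: UP|by apply/andP; split; lra].
rewrite (bigD1 a)//= eqxx mul1r big1 ?addr0; last first.
  by move=> b /negbTE ->; rewrite mul0r.
rewrite lee_fin; have [_ [_ /(_ m)]] := UP start a.
set t := tangency R a m in t0 t1 *; set x := P start a gain; set y := P _ _ loss.
move=> tan; have -> : 1 - (1 - 2 * t) = 2 * t by ring.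
rewrite -subr_ge0.
have -> : x / (2 * t) - y - - (t / 2) = (x - (2 * t * y - t ^+ 2)) / (2 * t).
  by field; rewrite gt_eqF.
by rewrite divr_ge0 ?subr_ge0//; lra.
Qed.

Lemma worst_return_lt (pi : policy R state bool) a m :
  0 < pi [::] start (~~ a) ->
  (worst_return M (1 - 2 * tangency R a m) pi < (- (tangency R a m / 2))%:E)%E.
Proof.
move=> pi0; have t0 := tangency_gt0 a m; have t1 := tangency_le a m.
set t := tangency R a m in t0 t1 *.
(* Nature takes y = t against both actions. The returns are t/2 - t = - t/2 for [a] and 3t/8 - t = -
   5t/8 for the other action, so any weight on the latter is a strict loss. *)
pose p (b : bool) := lottery R (if b == a then t ^+ 2 else 3 / 4 * t ^+ 2) t.
have pU b : oscillating_set R start b (p b).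
  apply: lottery_oscillating_set => [||| n].
  - by case: ifP => _; nra.
  - exact: ltW.
  - by case: ifP => _; nra.
  - case: eqP => [->|/eqP ba].
      (* The point (t^2, t) is on the parabola, above the tangent at s by (t - s)^2. *)
      by rewrite -subr_ge0; have := sqr_ge0 (t - tangency R a n); lra.
    have -> : b = ~~ a by case: (b) (a) ba => -[].
    exact: tangency_gap.
have UP := branching_oscillating_set R p pU.
pose K := TransitionKernel (oscillating_uncertainty_stochastic R _ UP).
apply: (@le_lt_trans _ _ (discounted_return M (1 - 2 * t) pi K)).
  by apply: ereal_inf_lbound; exists K.
rewrite oscillating_return; [|exact: UP|by apply/andP; split; lra].
rewrite lte_fin (bigD1 (~~ a))//= (bigD1 a)/=; last by case: (a).
rewrite [X in _ + (_ + X)]big1 ?addr0; last by case: (a) => -[].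
have [_] := policyP pi [::] start.
rewrite (bigD1 (~~ a))//= (bigD1 a)/=; last by case: (a).
rewrite [X in _ + (_ + X)]big1 ?addr0; last by case: (a) => -[].
rewrite /branching eqxx /p/= eqxx.
have -> : (~~ a == a) = false by case: (a).
rewrite /lottery/= => pi1.
have -> : 1 - (1 - 2 * t) = 2 * t by ring.
have -> : 3 / 4 * t ^+ 2 / (2 * t) = 3 / 8 * t by field; rewrite gt_eqF.
have -> : t ^+ 2 / (2 * t) = t / 2 by field; rewrite gt_eqF.
by nra.
Qed.

(** The action [a] depends on the policy alone, so it stays fixed while the discount factor tends to
    1. *)
Lemma policy_first_action (pi : policy R state bool) :
  exists a, 0 < pi [::] start (~~ a).
Proof.
have [p0 p1] := policyP pi [::] start.
have [pt|pf] := ltP 0 (pi [::] start true); first by exists false.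
exists true; move: p1; rewrite big_bool/=.
have := p0 false; lra.
Qed.

End oscillating_return.

Theorem theorem4p4 (R : realType) :
  exists (S A : pfinType) (M : rmdp R S A),
    [/\ sa_rectangular M,
        convex_uncertainty M,
        (* the infimum over the uncertainty set is a minimum *)
        (forall (pi : policy R S A) (gamma : R), 0 < gamma < 1 ->
           exists2 P : transition_kernel R S A, uncertainty M P &
             discounted_return M gamma pi P = worst_return M gamma pi),
        ~ (exists pi : policy R S A, blackwell_optimal M pi) &
        forall (pi : policy R S A) (gamma : R), 0 < gamma < 1 ->
          exists2 gamma' : R, gamma < gamma' < 1 &
            (worst_return M gamma' pi <
             ereal_sup [set worst_return M gamma' pi' |
                        pi' in [set pi' : policy R S A | stationary pi']])%E].
Proof.
exists state, bool, (oscillating_rmdp R).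
(* Proved first because it also rules out Blackwell optimality. *)
have suboptimal (pi : policy R state bool) (gamma : R) : 0 < gamma < 1 ->
    exists2 gamma' : R, gamma < gamma' < 1 &
      (worst_return (oscillating_rmdp R) gamma' pi <
       ereal_sup [set worst_return (oscillating_rmdp R) gamma' pi' |
                  pi' in [set pi' : policy R state bool | stationary pi']])%E.
  move=> /andP[g0 g1]; have [a pia] := policy_first_action R pi.
  have [m tm] : exists m, 2 * tangency R a m < 1 - gamma.
    by apply: tangency_small; rewrite subr_gt0.
  exists (1 - 2 * tangency R a m).
    by have := tangency_gt0 R a m; move=> ?; apply/andP; split; lra.
  apply: lt_le_trans (worst_return_lt R pi a m pia) _.
  apply: le_trans (worst_return_always_ge R a m) _.
  by apply: ereal_sup_ubound; exists (always R a) => //; exact: always_stationary.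
split.
- exact: oscillating_rmdp_rectangular.
- exact: oscillating_rmdp_convex.
- by move=> pi gamma; exact: worst_return_attained.
- move=> [pi [gamma0 g01 opt]].
  have [gamma /opt le_opt] := suboptimal pi gamma0 g01.
  rewrite ltNge => /negP; apply; apply: le_trans le_opt.
  (* The supremum over stationary policies is at most the one over all policies. *)
  by apply: le_ereal_sup => _ [pi' _ <-]; exists pi'.
- exact: suboptimal.
Qed.
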